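(* Let $H$ be a real Hilbert space, $C\subseteq H$ a nonempty, convex and closed set, and $F:H\to H$ an operator such that the solution set $\Omega$ of $\mathrm{VI}(F,C)$ is nonempty. Assume that $F$ is pseudo-monotone on $H$, Lipschitz continuous with constant $L>0$ and sequentially weak-to-weak continuous, and let $0<\lambda<\frac1L$. Let $(\rho_n)_{n\ge0}\subseteq[0,1]$ with $\liminf_{n\to+\infty}\rho_n>0$. Let $x_0\in H$ and let, for all $n\ge0$, $$y_n=P_C(x_n-\lambda F(x_n)),\qquad x_{n+1}=\rho_n\left(y_n+\lambda(F(x_n)-F(y_n))\right)+(1-\rho_n)x_n,$$ and assume that $x_n\ne y_n$ and $F(y_n)\neq0$ for every $n\ge0$. Then the sequence $(x_n)_{n\ge0}$ converges weakly to a solution of $\mathrm{VI}(F,C)$.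
   Context: $\mathrm{VI}(F,C)$ is the problem of finding $x^*\in C$ such that $\langle F(x^* ),x-x^*\rangle\ge 0$ for all $x\in C$; $\Omega$ denotes its solution set. $P_C$ is the metric projection onto $C$. $F$ is pseudo-monotone on a set $S\subseteq H$ if for all $x,y\in S$: $\langle F(x),y-x\rangle\ge 0\Rightarrow\langle F(y),y-x\rangle\ge0$. $F$ is Lipschitz continuous with constant $L$ if $\|F(x)-F(y)\|\le L\|x-y\|$ for all $x,y\in H$. $F$ is sequentially weak-to-weak continuous if $x_n\rightharpoonup x$ implies $F(x_n)\rightharpoonup F(x)$. The iteration is Tseng's forward-backward-forward algorithm with relaxation parameters $(\rho_n)$; the algorithm stops if $y_n=x_n$ or $F(y_n)=0$, and the assumption that this never occurs means that it generates an infinite sequence. *)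

(* Defs.v *)
From HB Require Import structures.
From mathcomp Require Import all_boot all_order all_algebra.
From mathcomp Require Import all_classical all_reals all_analysis.
Set Implicit Arguments.
Unset Strict Implicit.
Unset Printing Implicit Defensive.
Import Order.TTheory GRing.Theory Num.Theory.
Import numFieldNormedType.Exports.
Local Open Scope classical_set_scope.
Local Open Scope ring_scope.

(* [{dot H for idfun}] is a positive definite bilinear form, symmetric since a
   hermitian form for the identity involution is symmetric; [sqr_norm_inner]
   makes the complete norm of [H] the one it induces. *)
HB.mixin Record CompleteNormedModule_isHilbert (R : realType) H
    of CompleteNormedModule R H := {
  inner : {dot H for (@idfun R)} ;
  sqr_norm_inner : forall x : H, `|x| ^+ 2 = inner x x }.

#[short(type="hilbertType")]
HB.structure Definition Hilbert (R : realType) :=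
  { H of CompleteNormedModule R H & CompleteNormedModule_isHilbert R H }.

Section Definitions.
Context {R : realType} {H : hilbertType R}.
Implicit Types (C S : set H) (F : H -> H) (u : nat -> H).

Definition VI_solutions F C : set H :=
  [set p | C p /\ forall x, C x -> 0 <= inner (F p) (x - p)].

Definition nearest_points C (v : H) : set H :=
  [set p | C p /\ forall z, C z -> `|v - p| <= `|v - z|].

(* [get] selects an element of a nonempty set; when [C] is nonempty, closed and
   convex, [nearest_points C v] is a singleton by the projection theorem. *)
Definition metric_proj C (v : H) : H := get (nearest_points C v).

Definition pseudo_monotone_on S F : Prop :=
  forall x y, S x -> S y ->
    0 <= inner (F x) (y - x) -> 0 <= inner (F y) (y - x).

Definition weakly_cvg u (p : H) : Prop :=
  forall z : H, inner (u n) z @[n --> \oo] --> inner p z.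

Definition seq_weak_to_weak_continuous F : Prop :=
  forall u p, weakly_cvg u p -> weakly_cvg (F \o u) (F p).

End Definitions.

(* Main.v *)
Require Import Defs.
From HB Require Import structures.
From mathcomp Require Import all_boot all_order all_algebra.
From mathcomp Require Import all_classical all_reals all_analysis.
From mathcomp Require Import ring lra.
Set Implicit Arguments.
Unset Strict Implicit.
Unset Printing Implicit Defensive.
Import Order.TTheory GRing.Theory Num.Theory.
Import numFieldNormedType.Exports.
Local Open Scope classical_set_scope.
Local Open Scope ring_scope.

(* For a solution p, pseudo-monotonicity and the variational inequality of the
   projection give `|x n.+1 - p|^2 <=
   `|x n - p|^2 - rho n * (1 - (lambda * L)^2) * `|x n - y n|^2, so x is Fejer
   monotone with respect to the solutions and x n - y n tends to 0 strongly.
   Every weak cluster point of x satisfies the Minty inequality, hence is a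
   solution, and Opial's argument concludes. Bounded sequences have weakly
   convergent subsequences: the limit along an ultrafilter is a functional
   represented by some p (Riesz), and a subsequence is chosen to approach p when
   tested against p and the terms of the sequence; the test vectors on which it
   converges form a closed subspace, whose orthogonal complement it
   contains. *)

(** * Inner product algebra and the Cauchy-Schwarz inequality *)

Section InnerProduct.
Context {R : realType} {H : hilbertType R}.
Implicit Types (u v w z : H) (a : R).

Lemma innerC u v : inner u v = inner v u.
Proof. by rewrite hermC expr0 mul1r. Qed.

Lemma innerDl u v w : inner (u + v) w = inner u w + inner v w.
Proof. exact: linearDl. Qed.

Lemma innerZl a u v : inner (a *: u) v = a * inner u v.
Proof. exact: linearZl_LR. Qed.

Lemma innerNl u v : inner (- u) v = - inner u v.
Proof. by rewrite -scaleN1r innerZl mulN1r. Qed.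

Lemma innerDr u v w : inner w (u + v) = inner w u + inner w v.
Proof. exact: linearDr. Qed.

Lemma innerZr a u v : inner v (a *: u) = a * inner v u.
Proof. by rewrite innerC innerZl innerC. Qed.

Lemma innerNr u v : inner v (- u) = - inner v u.
Proof. by rewrite innerC innerNl innerC. Qed.

Definition innerE := (innerDl, innerDr, innerNl, innerNr, innerZl, innerZr).

Lemma sqr_normD u v : `|u + v| ^+ 2 = `|u| ^+ 2 + 2 * inner u v + `|v| ^+ 2.
Proof. by rewrite !sqr_norm_inner !innerE (innerC v u); ring. Qed.

Lemma cauchy_schwarz u v : `|inner u v| <= `|u| * `|v|.
Proof.
have [->|v0] := eqVneq v 0; first by rewrite linear0r !normr0 mulr0.
have nv : 0 < `|v| by rewrite normr_gt0.
rewrite -(@ler_pXn2r _ 2) ?nnegrE ?mulr_ge0// real_normK ?num_real//.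
(* The vector is the component of [u] orthogonal to [v]; multiplying its squared norm by [|v|^2]
   clears the denominators. *)
have := sqr_ge0 `|u - (inner u v / `|v| ^+ 2) *: v|.
rewrite sqr_normD innerNr normrN innerZr normrZ exprMn real_normK ?num_real//.
set b := inner u v => h.
have /= := mulr_ge0 (sqr_ge0 `|v|) h.
suff -> : `|v| ^+ 2 * (`|u| ^+ 2 + 2 * - (b / `|v| ^+ 2 * b) +
  (b / `|v| ^+ 2) ^+ 2 * `|v| ^+ 2) = (`|u| * `|v|) ^+ 2 - b ^+ 2.
  by rewrite subr_ge0.
by field; rewrite gt_eqF.
Qed.

Lemma scalar_inner z : scalar (inner z).
Proof. by move=> a u v; rewrite !innerE. Qed.

End InnerProduct.

(** Stands in for letting [t] tend to 0 in first-order arguments. If [a > 0], the choice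
    [t = a / (a + b)] gives [a * (a + b) <= a * b], which is absurd. *)
Lemma le0_scale01 {R : realFieldType} (a b : R) : 0 <= b ->
  (forall t, 0 < t <= 1 -> a <= t * b) -> a <= 0.
Proof.
move=> b0 ab; rewrite leNgt; apply/negP => a0.
have ab0 : 0 < a + b by rewrite ltr_wpDr.
have := ab (a / (a + b)); rewrite divr_gt0// ler_pdivrMr// mul1r lerDl.
move=> /(_ b0); rewrite mulrAC ler_pdivlMr//.
by apply/negP; rewrite -ltNge mulrDr ltrDr mulr_gt0.
Qed.

Lemma dist_le_cvg {R : realFieldType} (V : pseudoMetricNormedZmodType R) T
    (G : set_system T) (f : T -> V) (g : T -> R) (l : V) : Filter G ->
  (\forall t \near G, `|f t - l| <= g t) -> g t @[t --> G] --> 0 ->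
  f t @[t --> G] --> l.
Proof.
move=> FG fg g0; apply/subr_cvg0/norm_cvg0P.
apply: (squeeze_cvgr _ (cvg_cst (0 : R)) g0).
by apply: filterS fg => t ->; rewrite normr_ge0.
Qed.

(** * Quadratic minimisation on closed convex sets, Riesz representation and metric projection *)

Section Projection.
Context {R : realType} {H : hilbertType R}.
Implicit Types (u v w z : H) (a : R) (C : set H).

Lemma convex_set_segment C u v a : convex_set C -> C u -> C v -> 0 <= a <= 1 ->
  C (v + a *: (u - v)).
Proof.
move=> Cc Cu Cv /andP[a0 a1].
have := Cc u v (Itv01 a0 a1); rewrite !inE => /(_ Cu Cv).
suff -> : conv (Itv01 a0 a1) (u : convex_lmodType H) v = v + a *: (u - v) by [].
rewrite -[LHS]/(a *: u + (1 - a) *: v).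
by rewrite scalerBl scale1r scalerBr addrCA.
Qed.

Lemma scalarB (f : H -> R) : scalar f -> {morph f : u v / u - v}.
Proof. by move=> fl u v; rewrite addrC -scaleN1r fl mulN1r addrC. Qed.

Lemma bounded_scalar_cvg (f : H -> R) (M : R) T (G : set_system T)
    (g : T -> H) p : Filter G ->
  scalar f -> (forall z, `|f z| <= M * `|z|) ->
  g t @[t --> G] --> p -> f (g t) @[t --> G] --> f p.
Proof.
move=> FG fl fM gp.
apply: (@dist_le_cvg _ _ _ _ _ (fun t => M * `|g t - p|)).
  by apply: nearW => t; rewrite -scalarB.
rewrite -(mulr0 M); apply: cvgMl_tmp; apply/norm_cvg0P.
exact/subr_cvg0.
Qed.

(* The minimiser of [`|z| ^+ 2 - 2 * f z] on [C]. *)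
Lemma stampacchia C (f : H -> R) (M : R) : C !=set0 -> convex_set C ->
  closed C -> scalar f -> (forall z, `|f z| <= M * `|z|) ->
  exists2 p, C p & forall z, C z -> f (z - p) <= inner p (z - p).
Proof.
move=> [c0 Cc0] Cc Ccl fl fM.
have fB := scalarB fl.
have fseg u v t : f (v + t *: (u - v)) = f v + t * f (u - v).
  by rewrite addrC fl addrC.
pose J z := `|z| ^+ 2 - 2 * f z.
have Jlb : has_inf (J @` C).
  split; first by exists (J c0), c0.
  (* [J z >= |z|^2 - 2 M |z| = (|z| - M)^2 - M^2]. *)
  exists (- M ^+ 2) => _ [z Cz <-]; rewrite /J.
  have := fM z; rewrite ler_norml => /andP[_ h].
  have := sqr_ge0 (`|z| - M); rewrite sqrrB; nra.
set m := inf (J @` C).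
have mJ z : C z -> m <= J z by move=> Cz; apply: (ge_inf (proj2 Jlb)); exists z.
have /choice[u uP] n : exists z, C z /\ J z < m + n.+1%:R^-1.
  have [|_ [z Cz <-] h] := @inf_adherent _ (J @` C) n.+1%:R^-1 _ Jlb.
    by rewrite invr_gt0 ltr0n.
  by exists z.
(* Parallelogram identity: [J z / 2 + J w / 2] exceeds [J] at the midpoint by [|z - w|^2 / 4], and
   the midpoint lies in [C], where [J] is at least [m]. Minimising sequences are therefore
   Cauchy. *)
have key z w : C z -> C w -> `|z - w| ^+ 2 <= 2 * (J z - m) + 2 * (J w - m).
  move=> Cz Cw.
  have half01 : 0 <= (2^-1 : R) <= 1 by lra.
  have := mJ _ (convex_set_segment Cc Cz Cw half01).
  have := sqr_normD w (z - w); rewrite subrKC.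
  rewrite /J (sqr_normD w (_ *: _)) fseg normrZ exprMn innerZr fB.
  have -> : `|2^-1 : R| = 2^-1 by rewrite ger0_norm.
  lra.
have cu : cvgn u.
  apply/cauchy_cvgP/cauchy_ballP => e e0.
  have e4 : 0 < e ^+ 2 / 4 by rewrite divr_gt0 ?exprn_gt0.
  have ue : \forall z \near u n @[n --> \oo], C z /\ J z - m < e ^+ 2 / 4.
    apply: filterS (near_infty_natSinv_lt (PosNum e4)) => n ne.
    by split; [exact: (uP n).1|rewrite ltrBlDl (lt_trans (uP n).2)// ltrD2l].
  near=> ij.
  have [C1 h1] : C ij.1 /\ J ij.1 - m < e ^+ 2 / 4.
    by near: ij; apply: (cvg_fst ue).
  have [C2 h2] : C ij.2 /\ J ij.2 - m < e ^+ 2 / 4.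
    by near: ij; apply: (cvg_snd ue).
  rewrite -ball_normE /= -(@ltr_pXn2r _ 2) ?nnegrE ?(ltW e0)//.
  apply: le_lt_trans (key _ _ C1 C2) _; lra.
pose p := limn u.
have Cp : C p.
  by apply: (closed_cvg _ Ccl _ _ cu); apply: nearW => n; case: (uP n).
have Jp : J p <= m.
  have c1 : J (u n) @[n --> \oo] --> J p.
    apply: cvgB; last exact: cvgMl_tmp (bounded_scalar_cvg _ fl fM cu).
    by apply: cvgM; apply: cvg_norm.
  have c2 : m + harmonic n @[n --> \oo] --> m + 0.
    by apply: cvgD; [exact: cvg_cst|exact: cvg_harmonic].
  rewrite -(addr0 m); apply: (ler_cvg_to c1 c2).
  by apply: nearW => n; rewrite ltW; case: (uP n).
exists p => // z Cz.
(* First-order condition at the minimiser: expand [J p <= J (p + t (z - p))], divide by [2 t] and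
   let [t] tend to 0. *)
rewrite -subr_le0; apply: (@le0_scale01 _ _ (`|z - p| ^+ 2 / 2)).
  by rewrite divr_ge0 ?sqr_ge0.
move=> t /andP[t0 t1].
have t01 : 0 <= t <= 1 by rewrite ltW.
have := le_trans Jp (mJ _ (convex_set_segment Cc Cz Cp t01)).
rewrite /J (sqr_normD p) fseg normrZ exprMn innerZr (gtr0_norm t0) => h.
rewrite -(ler_pM2l t0); nra.
Unshelve. all: by end_near.
Qed.

(** On the whole space the minimiser [p] may be tested at both [p + z] and [p - z], which turns its
    inequality into an equality. *)
Lemma riesz (f : H -> R) (M : R) :
  scalar f -> (forall z, `|f z| <= M * `|z|) ->
  exists p, forall z, f z = inner p z.
Proof.
move=> fl fM.
have [||p _ pP] := stampacchia _ _ closedT fl fM; first by exists 0.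
  by move=> *; rewrite inE.
exists p => z; apply/eqP; rewrite eq_le; apply/andP; split.
  by have := pP (p + z) I; rewrite addrAC subrr add0r.
have f0 : f 0 = 0 by have := scalarB fl 0 0; rewrite !subrr.
have := pP (p - z) I; rewrite addrAC subrr (scalarB fl) f0 !sub0r innerNr.
by rewrite lerN2.
Qed.

(** For the functional [inner v], the quantity minimised is [|z - v|^2] up to a constant. *)
Lemma projection_exists C v : C !=set0 -> convex_set C -> closed C ->
  exists2 p, C p & forall z, C z -> inner (v - p) (z - p) <= 0.
Proof.
move=> C0 Cc Ccl.
have [p Cp pP] := stampacchia C0 Cc Ccl (scalar_inner v) (cauchy_schwarz v).
by exists p => // z Cz; rewrite innerDl innerNl subr_le0 pP.
Qed.

(** The obtuse angle inequality at [p] yields [|v - p|^2 + |p - z|^2 <= |v - z|^2] on [C], so [p] is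
    the only nearest point and [get] can select no other. *)
Lemma metric_projP C v : C !=set0 -> convex_set C -> closed C ->
  C (metric_proj C v) /\
  forall z, C z -> inner (v - metric_proj C v) (z - metric_proj C v) <= 0.
Proof.
move=> C0 Cc Ccl; have [p Cp pP] := projection_exists v C0 Cc Ccl.
have dist z : C z -> `|v - p| ^+ 2 + `|p - z| ^+ 2 <= `|v - z| ^+ 2.
  move=> Cz; rewrite -[v - z](subrKA p) (sqr_normD (v - p)).
  by have := pP _ Cz; rewrite -(opprB p z) (innerNr (p - z)); lra.
have : nearest_points C v (metric_proj C v).
  apply: (@getPex _ (nearest_points C v)); exists p; split=> // z Cz.
  rewrite -(@ler_pXn2r _ 2) ?nnegrE//.
  by have := dist _ Cz; have := sqr_ge0 `|p - z|; lra.
set q := metric_proj C v => -[Cq qmin].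
suff -> : q = p by [].
have := qmin _ Cp; rewrite -(@ler_pXn2r _ 2) ?nnegrE// => qp.
have /eqP : `|p - q| ^+ 2 = 0.
  by apply/eqP; rewrite eq_le sqr_ge0 andbT; have := dist _ Cq; lra.
by rewrite sqrf_eq0 normr_eq0 subr_eq0 => /eqP.
Qed.

End Projection.

(** * Weak sequential compactness of bounded sequences *)

Lemma ultra_bounded_cvg {R : realType} T (U : set_system T) (g : T -> R) M :
  UltraFilter U -> (forall t, `|g t| <= M) ->
  exists l : R, g t @[t --> U] --> l.
Proof.
move=> UU gM; have UP : ProperFilter U by exact: ultra_proper.
have gI : \forall t \near U, `[- M, M]%classic (g t).
  by apply: nearW => t /=; rewrite in_itv /= -ler_norml.
have [l [_ lU]] := @segment_compact _ (- M) M (g t @[t --> U]) _ gI.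
(* A cluster point of an ultrafilter is a limit: a neighbourhood outside the ultrafilter would have
   its complement inside, against clustering. *)
exists l => V lV; case: (in_ultra_setVsetC (g @^-1` V) UU) => // gV.
by have [r [nVr Vr]] := lU (~` V) V gV lV.
Qed.

Section WeakCompactness.
Context {R : realType} {H : hilbertType R}.
Implicit Types (v z p : H) (S : set H) (u : nat -> H).

(** In a subspace the projection inequality may be tested at [q + s] and at [q - s], which gives
    orthogonality. *)
Lemma subspace_projection S v : closed S -> S 0 ->
    (forall (a : R) x y, S x -> S y -> S (a *: x + y)) ->
  exists2 q, S q & forall s, S s -> inner (v - q) s = 0.
Proof.
move=> Scl S0 Slin.
have Sc : convex_set (S : set (convex_lmodType H)).
  move=> x y t; rewrite !inE => Sx Sy; apply: (Slin _ x _ Sx).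
  by rewrite -[X in S X]addr0; apply: Slin.
have [|q Sq qP] := projection_exists v _ Sc Scl; first by exists 0.
exists q => // s Ss; apply/eqP; rewrite eq_le; apply/andP; split.
  have := qP (1 *: s + q) (Slin _ _ _ Ss Sq).
  by rewrite addrK scale1r.
have := qP (-1 *: s + q) (Slin _ _ _ Ss Sq).
by rewrite addrK innerZr mulN1r oppr_le0.
Qed.

(** A subsequence is encoded by [k <= phi k], which makes [phi] tend to infinity, so limits of the
    full sequence pass to it. *)
Lemma weak_compactness u M : (forall n, `|u n| <= M) ->
  exists phi p, (forall k, (k <= phi k)%N) /\ weakly_cvg (u \o phi) p.
Proof.
move=> uM.
(* Along an ultrafilter finer than [\oo], the bounded sequences [inner (u n) z] converge for all [z]
   at once. *)
have [U [UU oU]] := @ultraFilterLemma _ (\oo : set_system nat) _.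
have UP : ProperFilter U by exact: ultra_proper.
have uzM n z : `|inner (u n) z| <= M * `|z|.
  by rewrite (le_trans (cauchy_schwarz _ _))// ler_wpM2r.
have /choice[f fP] z := ultra_bounded_cvg UU (fun n => uzM n z).
have fl : scalar f.
  move=> a v z; apply: (cvg_unique _ (fP _)) => //.
  rewrite (_ : (fun n => _) =
    fun n => a * inner (u n) v + inner (u n) z); last first.
    by apply/funext => n; rewrite !innerE.
  by apply: cvgD (fP z); apply: cvgMl_tmp.
have fM z : `|f z| <= M * `|z|.
  apply: (ler_cvg_to (cvg_norm (fP z)) (cvg_cst _)).
  by apply: nearW => n; exact: uzM.
have [p pP] := riesz fl fM.
have close k z : \forall n \near U, `|inner (u n - p) z| < k.+1%:R^-1.
  have k0 : 0 < k.+1%:R^-1 :> R by rewrite invr_gt0 ltr0n.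
  apply: filterS (cvgr_dist_lt _ _ (fP z) _ k0) => n.
  by rewrite innerDl innerNl -pP distrC.
(* Stage [k] imposes finitely many conditions, each true on a set of [U], so a common index exists.
   A fixed [u m] is controlled from stage [m + 1] on. *)
have /choice[phi phiP] k : exists n, [/\ (k <= n)%N,
    `|inner (u n - p) p| < k.+1%:R^-1 &
    forall m, (m < k)%N -> `|inner (u n - p) (u m)| < k.+1%:R^-1].
  suff : \forall n \near U, [/\ (k <= n)%N,
      `|inner (u n - p) p| < k.+1%:R^-1 &
      forall m, (m < k)%N -> `|inner (u n - p) (u m)| < k.+1%:R^-1].
    by move/filter_ex.
  have cm : \forall n \near U,
      forall m : 'I_k, `|inner (u n - p) (u m)| < k.+1%:R^-1.
    by apply: filter_forall => m; exact: close.
  have kn : \forall n \near U, (k <= n)%N by apply: oU; exact: nbhs_infty_ge.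
  near=> n; split; [by near: n|by near: n; exact: close|].
  move=> m mk.
  have h : forall m : 'I_k, `|inner (u n - p) (u m)| < k.+1%:R^-1 by near: n.
  exact: (h (Ordinal mk)).
exists phi, p; split; first by move=> k; case: (phiP k).
pose S := [set z | inner (u (phi k) - p) z @[k --> \oo] --> 0].
have harm : (k.+1%:R^-1 : R) @[k --> \oo] --> 0 by exact: cvg_harmonic.
have Sp : S p.
  apply: dist_le_cvg harm; apply: nearW => k.
  by rewrite subr0 ltW//; case: (phiP k).
have Su m : S (u m).
  apply: dist_le_cvg harm; near=> k.
  rewrite subr0 ltW//; have [_ _] := phiP k; apply.
  by near: k; exact: nbhs_infty_gt.
have Slin (a : R) x y : S x -> S y -> S (a *: x + y).
  rewrite /S /= => Sx Sy.
  rewrite (_ : (fun k => _) = fun k =>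
    a * inner (u (phi k) - p) x + inner (u (phi k) - p) y); last first.
    by apply/funext => k; rewrite innerDr innerZr.
  suff : a * inner (u (phi k) - p) x + inner (u (phi k) - p) y
      @[k --> \oo] --> a * 0 + 0 by rewrite mulr0 addr0.
  by apply: cvgD Sy; exact: cvgMl_tmp.
have S0 : S 0.
  by rewrite /S /=; under eq_fun do rewrite linear0r; exact: cvg_cst.
have Scl : closed S.
  move=> z clz; apply/cvgr0Pnorm_lt => e e0.
  (* Uniform bound on the norms of [u (phi k) - p]; the added 1 makes it positive. *)
  pose K := M + `|p| + 1.
  have M0 : 0 <= M by exact: le_trans (normr_ge0 _) (uM 0).
  have K0 : 0 < K by rewrite ltr_wpDl ?addr_ge0.
  have eK0 : 0 < e / 2 / K by rewrite !divr_gt0.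
  have [s [Ss]] := clz _ (nbhsx_ballx z _ eK0).
  rewrite -ball_normE /= ltr_pdivlMr// => zs.
  have e20 : 0 < e / 2 by rewrite divr_gt0.
  near=> k.
  have ks : `|inner (u (phi k) - p) s| < e / 2.
    by near: k; exact: (cvgr0_norm_lt _ Ss).
  rewrite -(subrK s z) innerDr [ltRHS]splitr.
  apply: le_lt_trans (ler_normD _ _) _; apply: ltrD ks.
  apply: le_lt_trans (cauchy_schwarz _ _) _; apply: le_lt_trans zs.
  rewrite mulrC ler_wpM2l// (le_trans (ler_normB _ _))// /K.
  by have := uM (phi k); lra.
(* Only the component [q] of [z] in [S] matters: [z - q] is orthogonal to [S], hence to [p] and to
   every [u m]. *)
have Sz z : S z.
  have [q Sq qP] := subspace_projection z Scl S0 Slin.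
  rewrite /S /= (_ : (fun k => _) = fun k => inner (u (phi k) - p) q)//.
  apply/funext => k; rewrite -[in LHS](subrK q z) innerDr [X in X + _]innerC.
  have orth s : S s -> inner s (z - q) = 0 by rewrite innerC; exact: qP.
  rewrite innerDr innerNr [inner _ p]innerC [inner _ (u _)]innerC.
  by rewrite !orth// subr0 add0r.
move=> z; apply/subr_cvg0.
by under eq_fun do rewrite -innerNl -innerDl; exact: Sz.
Unshelve. all: by end_near.
Qed.

End WeakCompactness.

(** * Weak cluster points and Opial's lemma *)

Lemma ge_id_cvg_infty (phi : nat -> nat) :
  (forall k, (k <= phi k)%N) -> phi k @[k --> \oo] --> \oo.
Proof.
move=> phiP; apply/cvgnyPge => A.
by apply: filterS (nbhs_infty_ge A) => k /leq_trans; apply.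
Qed.

Section Opial.
Context {R : realType} {H : hilbertType R}.
Implicit Types (p q z : H) (x : nat -> H) (S : set H).

(** The difference of the two squared distances is [2 * inner (x n) (q - p)] up to a constant, so
    this converges along the whole sequence. Both cluster points then have the same inner product
    with [q - p]. *)
Lemma weak_cluster_unique x (phi psi : nat -> nat) p q :
  (forall k, (k <= phi k)%N) -> (forall k, (k <= psi k)%N) ->
  weakly_cvg (x \o phi) p -> weakly_cvg (x \o psi) q ->
  cvgn (fun n => `|x n - p| ^+ 2) -> cvgn (fun n => `|x n - q| ^+ 2) -> p = q.
Proof.
move=> phiP psiP xp xq cp cq.
pose c n := `|x n - p| ^+ 2 - `|x n - q| ^+ 2 + (`|q| ^+ 2 - `|p| ^+ 2).
have cE : c = fun n => 2 * inner (x n) (q - p).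
  by apply/funext => n; rewrite /c !sqr_normD !innerDr !innerNr !normrN; ring.
have [l cl] : exists l : R, c n @[n --> \oo] --> l.
  by eexists; apply: cvgD (cvg_cst _); exact: cvgB cp cq.
have uniq (chi : nat -> nat) r : (forall k, (k <= chi k)%N) ->
    weakly_cvg (x \o chi) r -> 2 * inner r (q - p) = l.
  move=> chiP xr; apply: (@cvg_unique _ _ (c (chi k) @[k --> \oo])).
  - exact: norm_hausdorff.
  - by rewrite cE; apply: cvgMl_tmp; exact: xr.
  - exact: cvg_comp (ge_id_cvg_infty chiP) cl.
have : `|q - p| ^+ 2 = 0.
  rewrite sqr_norm_inner innerDl innerNl.
  by have := uniq _ _ phiP xp; have := uniq _ _ psiP xq; lra.
by move/eqP; rewrite sqrf_eq0 normr_eq0 subr_eq0 => /eqP.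
Qed.

(** If weak convergence to a cluster point [p] failed, some [z] would keep a subsequence at distance
    [e] from [p] when tested against [z]. A further subsequence converges weakly, and uniqueness
    makes its limit [p], a contradiction. *)
Lemma opial x S (M : R) : (forall n, `|x n| <= M) ->
  (forall p, S p -> cvgn (fun n => `|x n - p| ^+ 2)) ->
  (forall (phi : nat -> nat) q, (forall k, (k <= phi k)%N) ->
    weakly_cvg (x \o phi) q -> S q) ->
  exists2 p, S p & weakly_cvg x p.
Proof.
move=> xM Scvg Sclu.
have [phi [p [phiP xp]]] := weak_compactness xM.
have Sp := Sclu _ _ phiP xp.
exists p => // z; apply: contrapT => nxp.
have [e [e0 far]] : exists e : R, 0 < e /\
    forall N, exists n, (N <= n)%N /\ e <= `|inner p z - inner (x n) z|.
  apply: contrapT => nfar; apply: nxp; apply/cvgrPdist_lt => e e0.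
  apply: contrapT => nnear; apply: nfar; exists e; split=> // N.
  apply: contrapT => nN; apply: nnear; exists N => // n /= Nn.
  by rewrite ltNge; apply/negP => ?; apply: nN; exists n.
have [psi psiP] := choice far.
have [chi [q [chiP xq]]] := weak_compactness (fun n => xM (psi n)).
have psichiP k : (k <= (psi \o chi) k)%N.
  by rewrite (leq_trans (chiP k))//; case: (psiP (chi k)).
have pq : p = q.
  apply: (weak_cluster_unique phiP psichiP) => //; apply: Scvg => //.
  exact: Sclu psichiP _.
have [N _ /(_ N (leqnn N))] := cvgr_dist_lt _ _ (xq z) _ e0.
by rewrite -pq /= ltNge; case: (psiP (chi N)) => _ ->.
Qed.

End Opial.

(** The lower limit of a bounded sequence is the supremum of its tail infima, so some tail infimum
    is positive and serves as [c]. *)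
Lemma limn_inf_gt0 {R : realType} (rho : nat -> R) :
  (forall n, 0 <= rho n <= 1) -> 0 < limn_inf rho ->
  exists2 c, 0 < c & \forall n \near \oo, c <= rho n.
Proof.
move=> rho01; rewrite limn_infE; last first.
  exists 1; split=> // M M1 n _ /=.
  by have /andP[r0 r1] := rho01 n; rewrite ger0_norm// (le_trans r1)// ltW.
move=> /sup_gt[|_ [N _ <-] c0]; first by exists (infs rho 0%N), 0%N.
exists (infs rho N) => //; exists N => // n /= Nn.
apply: ge_inf; last by exists n.
by exists 0 => _ [k _ <-]; have /andP[] := rho01 k.
Qed.

(** * Minty's lemma, weak cluster points and the basic estimate of the forward-backward-forward
    step *)

Section VariationalInequality.
Context {R : realType} {H : hilbertType R}.
Variables (C : set H) (F : H -> H) (L : R).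
Hypotheses (C_neq0 : C !=set0) (C_convex : convex_set C) (C_closed : closed C).
Hypotheses (L_gt0 : 0 < L) (F_lipschitz : L.-lipschitz F).
Implicit Types (p q z : H).

Lemma lipschitz_le u v : `|F u - F v| <= L * `|u - v|.
Proof. exact: (F_lipschitz (conj I I : (setT `*` setT) (u, v))). Qed.

(** Test at [q + t (z - q)] and divide by [t]: replacing the value of [F] there by [F q] costs at
    most [t * L * |z - q|^2]. *)
Lemma minty q : C q -> (forall z, C z -> 0 <= inner (F z) (z - q)) ->
  VI_solutions F C q.
Proof.
move=> Cq hq; split=> // z Cz.
rewrite -oppr_le0; apply: (@le0_scale01 _ _ (L * `|z - q| ^+ 2)).
  by rewrite mulr_ge0 ?sqr_ge0// ltW.
move=> t /andP[t0 t1].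
have t01 : 0 <= t <= 1 by rewrite ltW.
have := hq _ (convex_set_segment C_convex Cz Cq t01).
rewrite [X in inner _ X]addrAC subrr add0r innerZr pmulr_rge0// => h.
have := le_trans (cauchy_schwarz (F (q + t *: (z - q)) - F q) (z - q))
  (ler_wpM2r (normr_ge0 _) (lipschitz_le _ _)).
rewrite [X in L * `|X|]addrAC subrr add0r normrZ (gtr0_norm t0) innerDl innerNl.
move=> /(le_trans (ler_norm _)); rewrite -!mulrA -expr2; nra.
Qed.

(** With [p] the projection of [q], the functional [inner (q - p)] is at most its value at [p] on
    [C]. This bound survives the weak limit and forces [|q - p|^2 <= 0]. *)
Lemma convex_closed_weakly_closed (u : nat -> H) q :
  (forall n, C (u n)) -> weakly_cvg u q -> C q.
Proof.
move=> Cu uq; have [p Cp pP] := projection_exists q C_neq0 C_convex C_closed.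
suff -> : q = p by [].
have h : inner (q - p) (q - p) <= 0.
  rewrite innerDr innerNr subr_le0 innerC.
  apply: (ler_cvg_to (uq (q - p)) (cvg_cst _)); apply: nearW => n.
  by rewrite -subr_le0 innerC -innerNr -innerDr pP.
have /eqP : `|q - p| ^+ 2 = 0.
  by apply/eqP; rewrite eq_le sqr_ge0 sqr_norm_inner h.
by rewrite sqrf_eq0 normr_eq0 subr_eq0 => /eqP.
Qed.

Variable lambda : R.
Hypothesis lambda_gt0 : 0 < lambda.

(** The projection inequality makes [y] an approximate solution: [x - y] and the Lipschitz
    replacement of [F x] by [F y] give the two terms of the error factor [1 + lambda * L]. *)
Lemma forward_backward_residual x y z : y = metric_proj C (x - lambda *: F x) ->
  C z ->
  - ((1 + lambda * L) * (`|x - y| * `|z - y|)) <= lambda * inner (F y) (z - y).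
Proof.
move=> yE Cz.
have [_ /(_ _ Cz)] := metric_projP (x - lambda *: F x) C_neq0 C_convex C_closed.
rewrite -yE addrAC innerDl innerNl innerZl => h1.
have := cauchy_schwarz (x - y) (z - y).
rewrite ler_norml => /andP[h2 _].
have := le_trans (cauchy_schwarz (F x - F y) (z - y))
  (ler_wpM2r (normr_ge0 _) (lipschitz_le _ _)).
rewrite ler_norml innerDl innerNl => /andP[_ h3].
have := ler_wpM2l (ltW lambda_gt0) h3.
by rewrite !mulrBr !mulrDl mul1r !mulrA; lra.
Qed.

Hypothesis F_pseudo_monotone : pseudo_monotone_on setT F.
Hypothesis F_weak_continuous : seq_weak_to_weak_continuous F.

(* If [F q != 0], then [<F (y n), F q>] tends to [`|F q| ^+ 2 > 0], so moving
   the test point [z] by [e *: F q] makes the residual inequality strict in the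
   limit, and pseudo-monotonicity applies. *)
Lemma forward_backward_weak_cluster (x y : nat -> H) q (M : R) :
  (forall n, y n = metric_proj C (x n - lambda *: F (x n))) ->
  (forall n, `|x n| <= M) -> `|x n - y n| @[n --> \oo] --> 0 ->
  weakly_cvg x q -> VI_solutions F C q.
Proof.
move=> yE xM xy0 xq.
have Cy n : C (y n).
  by rewrite yE; have [] := metric_projP (x n - lambda *: F (x n))
    C_neq0 C_convex C_closed.
have yq : weakly_cvg y q.
  move=> z.
  have d0 : inner (x n - y n) z @[n --> \oo] --> 0.
    apply: (@dist_le_cvg _ _ _ _ _ (fun n => `|x n - y n| * `|z|)).
      by apply: nearW => n; rewrite subr0 cauchy_schwarz.
    by rewrite -(mul0r `|z|); apply: cvgMr_tmp.
  have yE' : (fun n => inner (y n) z) =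
      fun n => inner (x n) z - inner (x n - y n) z.
    by apply/funext => n; rewrite innerDl innerNl; ring.
  by rewrite yE' -[inner q z]subr0; apply: cvgB d0; exact: xq.
have Cq : C q by exact: convex_closed_weakly_closed Cy yq.
have [Fq0|Fq0] := eqVneq (F q) 0.
  by split=> // z _; rewrite Fq0 linear0l.
apply: minty => // z Cz.
pose d := F q.
(* The last factor bounds [|z - y n|] through [x n], so the residual tends to 0. *)
have res0 : (1 + lambda * L) * (`|x n - y n| * (`|z| + M + `|x n - y n|))
    @[n --> \oo] --> 0.
  rewrite -(mulr0 (1 + lambda * L)) -(mul0r (`|z| + M + 0)).
  apply: cvgMl_tmp; apply: cvgM => //.
  by apply: cvgD => //; exact: cvg_cst.
have perturbed e : 0 < e -> 0 <= inner (F (z + e *: d)) (z + e *: d - q).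
  move=> e0; pose w := z + e *: d.
  have ev : \forall n \near \oo, 0 <= inner (F w) (w - y n).
    have gap : 0 < lambda * (e * inner (F q) d).
      by rewrite !mulr_gt0// -sqr_norm_inner exprn_gt0// normr_gt0.
    have lim : lambda * (e * inner (F (y n)) d) -
        (1 + lambda * L) * (`|x n - y n| * (`|z| + M + `|x n - y n|))
        @[n --> \oo] --> lambda * (e * inner (F q) d) - 0.
      apply: cvgB res0; apply: cvgMl_tmp; apply: cvgMl_tmp.
      exact: F_weak_continuous yq d.
    rewrite subr0 in lim.
    apply: filterS (cvgr_gt _ lim _ gap) => n pos.
    apply: F_pseudo_monotone => //.
    rewrite -(pmulr_rge0 _ lambda_gt0) /w addrAC innerDr innerZr mulrDr.
    have := forward_backward_residual (yE n) Cz.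
    have : `|z - y n| <= `|z| + M + `|x n - y n|.
      rewrite -[z - y n](subrKA (x n)) (le_trans (ler_normD _ _))// lerD2r.
      by rewrite (le_trans (ler_normB _ _))// lerD2l.
    move=> /(ler_wpM2l (normr_ge0 (x n - y n))) h.
    have L1 : 0 <= 1 + lambda * L by rewrite addr_ge0// mulr_ge0// ltW.
    by have := ler_wpM2l L1 h; lra.
  have lim : inner (F w) (w - y n) @[n --> \oo] --> inner (F w) (w - q).
    rewrite innerDr innerNr [inner _ q]innerC.
    rewrite [X in nbhs (X @ _)](_ : _ =
      fun n => inner (F w) w - inner (y n) (F w)); last first.
      by apply/funext => n; rewrite innerDr innerNr (innerC (y n)).
    by apply: cvgB (yq _); exact: cvg_cst.
  exact: (ler_cvg_to (cvg_cst _) lim).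
rewrite -oppr_le0.
(* Let the size [t] of the perturbation tend to 0. Expanding [inner (F (z + t d)) (z + t d - q)]
   around [inner (F z) (z - q)] leaves three errors, each at most [t] times a term of [b]; the
   quadratic one uses [t <= 1]. *)
pose b := L * `|d| * `|z - q| + `|F z| * `|d| + L * `|d| * `|d|.
apply: (@le0_scale01 _ _ b).
  by rewrite /b !addr_ge0// ?mulr_ge0// ltW.
move=> t /andP[t0 t1].
have := perturbed t t0.
set w := z + t *: d => h.
have Fw : `|F w - F z| <= L * (t * `|d|).
  rewrite (le_trans (lipschitz_le _ _))// /w addrAC subrr add0r.
  by rewrite normrZ gtr0_norm.
have := le_trans (cauchy_schwarz (F w - F z) (z - q))
  (ler_wpM2r (normr_ge0 _) Fw).
have := le_trans (cauchy_schwarz (F w - F z) d) (ler_wpM2r (normr_ge0 _) Fw).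
have := cauchy_schwarz (F z) d.
move=> /(le_trans (ler_norm _)) h1 /(le_trans (ler_norm _)) h2.
move=> /(le_trans (ler_norm _)) h3.
have tDD : t * (L * (t * `|d|) * `|d|) <= t * (L * `|d| * `|d|).
  by rewrite ler_pM2l// -!mulrA ler_pM2l// ler_piMl// mulr_ge0.
have := ler_wpM2l (ltW t0) h1; have := ler_wpM2l (ltW t0) h2.
move: h h3; rewrite {2}/w addrAC !(innerDl, innerNl, innerDr, innerNr).
rewrite innerZr /b.
lra.
Qed.

(** The projection inequality at [p] gives [lambda <F x, y - p> <= <x - y, y - p>], and
    pseudo-monotonicity gives [<F y, y - p> >= 0]. These absorb the cross terms of the expanded
    squares; what remains is [|lambda (F x - F y)|^2], bounded by the Lipschitz property. *)
Lemma tseng_step x y p : y = metric_proj C (x - lambda *: F x) ->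
  VI_solutions F C p ->
  `|y + lambda *: (F x - F y) - p| ^+ 2 <=
    `|x - p| ^+ 2 - (1 - (lambda * L) ^+ 2) * `|x - y| ^+ 2.
Proof.
move=> yE [Cp pP].
have [Cy /(_ _ Cp)] :=
  metric_projP (x - lambda *: F x) C_neq0 C_convex C_closed.
rewrite -yE in Cy *; rewrite -(opprB y p) innerNr oppr_le0.
rewrite addrAC innerDl innerNl innerZl => proj.
have /(ler_wpM2l (ltW lambda_gt0)) := F_pseudo_monotone I I (pP _ Cy).
rewrite mulr0 => mono.
have lip : `|F x - F y| ^+ 2 <= L ^+ 2 * `|x - y| ^+ 2.
  by rewrite -exprMn ler_pXn2r ?nnegrE ?mulr_ge0 ?lipschitz_le// ltW.
have := ler_wpM2l (sqr_ge0 lambda) lip.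
rewrite addrAC (sqr_normD (y - p)) normrZ exprMn real_normK ?num_real// innerZr.
rewrite -[x - p](subrKA y) (sqr_normD (x - y)) innerC innerDl innerNl.
lra.
Qed.

End VariationalInequality.

(** * Convergence of the relaxed iteration *)

Lemma sqr_norm_conv {R : realType} {H : hilbertType R} (u v : H) (t : R) :
  0 <= t <= 1 ->
  `|t *: u + (1 - t) *: v| ^+ 2 <= t * `|u| ^+ 2 + (1 - t) * `|v| ^+ 2.
Proof.
move=> /andP[t0 t1].
(* The two sides differ by exactly [t (1 - t) |u - v|^2]. *)
have := mulr_ge0 (mulr_ge0 t0 _ : 0 <= t * (1 - t)) (sqr_ge0 `|u - v|).
rewrite subr_ge0 => /(_ t1).
by rewrite !sqr_norm_inner !innerE (innerC v u); lra.
Qed.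

Theorem theorem3p1 (R : realType) (H : hilbertType R)
    (C : set H) (F : H -> H) (L lambda : R)
    (rho : nat -> R) (x y : nat -> H)
    (C_neq0 : C !=set0) (C_convex : convex_set C) (C_closed : closed C)
    (VI_neq0 : VI_solutions F C !=set0)
    (F_pseudo_monotone : pseudo_monotone_on setT F)
    (L_gt0 : 0 < L) (F_lipschitz : L.-lipschitz F)
    (F_weak_continuous : seq_weak_to_weak_continuous F)
    (lambda_gt0 : 0 < lambda) (lambda_lt : lambda < 1 / L)
    (rho_itv : forall n, 0 <= rho n <= 1)
    (rho_liminf : 0 < limn_inf rho)
    (y_def : forall n, y n = metric_proj C (x n - lambda *: F (x n)))
    (x_def : forall n, x n.+1 =
      rho n *: (y n + lambda *: (F (x n) - F (y n))) + (1 - rho n) *: x n)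
    (x_neq_y : forall n, x n != y n) (Fy_neq0 : forall n, F (y n) != 0) :
  exists2 p : H, VI_solutions F C p & weakly_cvg x p.
Proof.
have lL1 : 0 < 1 - (lambda * L) ^+ 2.
  rewrite ltr_pdivlMr// in lambda_lt.
  by rewrite subr_gt0 expr_lt1// mulr_ge0// ltW.
have [c c0 rho_c] := limn_inf_gt0 rho_itv rho_liminf.
(* The new error is the convex combination, with weight [rho n], of the unrelaxed error and the old
   one. *)
have descent p n : VI_solutions F C p -> `|x n.+1 - p| ^+ 2 <=
    `|x n - p| ^+ 2 - rho n * ((1 - (lambda * L) ^+ 2) * `|x n - y n| ^+ 2).
  move=> Sp; have /andP[r0 r1] := rho_itv n.
  have -> : x n.+1 - p = rho n *: (y n + lambda *: (F (x n) - F (y n)) - p) +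
      (1 - rho n) *: (x n - p).
    by rewrite x_def !scalerBr addrACA -opprD -scalerDl subrKC scale1r.
  apply: le_trans (sqr_norm_conv _ _ (rho_itv n)) _.
  have := tseng_step C_neq0 C_convex C_closed L_gt0 F_lipschitz lambda_gt0
    F_pseudo_monotone (y_def n) Sp.
  by move=> /(ler_wpM2l r0); lra.
have decr p : VI_solutions F C p ->
    {homo (fun n => `|x n - p| ^+ 2) : n m / (n <= m)%N >-> m <= n}.
  move=> Sp; apply/nonincreasing_seqP => n.
  apply: le_trans (descent p n Sp) _; rewrite gerBl.
  have /andP[r0 _] := rho_itv n.
  by rewrite !mulr_ge0 ?sqr_ge0// ltW.
have cvg_dist p : VI_solutions F C p -> cvgn (fun n => `|x n - p| ^+ 2).
  move=> Sp; apply: nonincreasing_is_cvgn; first exact: decr.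
  by exists 0 => _ [n _ <-]; exact: sqr_ge0.
have [p Sp] := VI_neq0.
have xM n : `|x n| <= `|x 0%N - p| + `|p|.
  rewrite -[x n](subrK p) (le_trans (ler_normD _ _))// lerD2r.
  by rewrite -(@ler_pXn2r _ 2) ?nnegrE//; exact: decr.
(* By descent, [k * |x n - y n|^2] is eventually at most the decrease of the squared distance to
   [p], which tends to 0 because these distances converge. *)
have xy0 : `|x n - y n| @[n --> \oo] --> 0.
  pose k := c * (1 - (lambda * L) ^+ 2).
  have k0 : 0 < k by exact: mulr_gt0.
  have dd : `|x n - p| ^+ 2 - `|x n.+1 - p| ^+ 2 @[n --> \oo] --> 0.
    have /cvg_ex[l cl] := cvg_dist p Sp.
    rewrite -(subrr l); apply: cvgB => //.
    by move: cl; rewrite -cvg_shiftS.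
  apply/cvgr0Pnorm_lt => e e0.
  have ke : 0 < k * e ^+ 2 by rewrite mulr_gt0// exprn_gt0.
  near=> n.
  have small : `|x n - p| ^+ 2 - `|x n.+1 - p| ^+ 2 < k * e ^+ 2.
    by near: n; exact: (cvgr_lt _ dd).
  have cn : c <= rho n by near: n.
  rewrite normr_id -(@ltr_pXn2r _ 2) ?nnegrE ?(ltW e0)// -(ltr_pM2l k0).
  apply: le_lt_trans small; rewrite lerBrDl -lerBrDr.
  apply: le_trans (descent p n Sp) _.
  rewrite lerD2l lerN2 [leRHS]mulrA; apply: ler_wpM2r; first exact: sqr_ge0.
  by apply: ler_wpM2r => //; exact: ltW.
apply: (opial xM cvg_dist) => phi q phiP xq.
apply: (forward_backward_weak_cluster C_neq0 C_convex C_closed L_gt0 F_lipschitz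
  lambda_gt0 F_pseudo_monotone F_weak_continuous (y := y \o phi) _ _ _ xq).
- by move=> n; exact: y_def.
- by move=> n; exact: xM.
- exact: cvg_comp (ge_id_cvg_infty phiP) xy0.
Unshelve. all: by end_near.
Qed.
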